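(* Let $K$ be a field and $S=K[x_1,\ldots,x_r,y_1,\ldots,y_s]$. Let $G$ be a bipartite graph with vertex set $V(G)=\{x_1,\ldots,x_r,y_1,\ldots,y_s\}$ and nonempty edge set $E(G)\subset\{x_1,\ldots,x_r\}\times\{y_1,\ldots,y_s\}$. For each edge $\{x_i,y_j\}\in E(G)$ let $a_{ij}$ and $b_{ij}$ be positive integers, and let \[ I=\bigcap_{\{x_i,y_j\}\in E(G)}(x_i^{a_{ij}},y_j^{b_{ij}}). \] Then \[ d(A(I))\ \geq\ \max\left\{\max_{i,j,l}\Big\{\frac{a_{ij}}{\gcd(a_{ij},a_{il})}\Big\},\ \max_{i,j,l}\Big\{\frac{b_{ij}}{\gcd(b_{ij},b_{lj})}\Big\}\right\}, \] where the first inner maximum is over all $i,j,l$ with $\{x_i,y_j\},\{x_i,y_l\}\in E(G)$, and the second is over all $i,j,l$ with $\{x_i,y_j\},\{x_l,y_j\}\in E(G)$.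
   Context: Symbolic powers: a monomial ideal $I\subset S$ has a unique irredundant presentation as an intersection of irreducible monomial ideals (ideals generated by powers of some of the variables). Intersecting those components having the same radical gives a canonical primary decomposition $I=\bigcap_i Q_i$ with pairwise distinct radicals, and the $k$th symbolic power of $I$ is $I^{(k)}=\bigcap_i Q_i^k$. For the ideal $I$ of the claim this gives $I^{(k)}=\bigcap_{\{x_i,y_j\}\in E(G)}(x_i^{a_{ij}},y_j^{b_{ij}})^k$. The symbolic power algebra of $I$ is $A(I)=\bigoplus_{k\ge0}I^{(k)}t^k\subset S[t]$, graded by the exponent of $t$, so that its degree-$0$ component is $S$; it is a finitely generated $S$-algebra. For a finitely generated graded $S$-algebra $A$, $d(A)$ denotes the highest degree of the minimal generators of $A$ as an $S$-algebra, i.e. the smallest integer $d$ such that $A$ is generated over $S$ by homogeneous elements of degree at most $d$. *)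

(* Defs.v *)
From mathcomp Require Import all_boot all_order all_algebra.
From mathcomp Require Import classical_sets.
From mathcomp Require Import mpoly.

Set Implicit Arguments.
Unset Strict Implicit.
Unset Printing Implicit Defensive.

Import GRing.Theory.

Local Open Scope classical_set_scope.
Local Open Scope ring_scope.

Section Ideals.
Variable R : comNzRingType.
Implicit Types (I G : set R) (k : nat).

Definition is_ideal I : Prop :=
  [/\ I 0, (forall f g, I f -> I g -> I (f + g))
    & (forall f g, I g -> I (f * g))].

Definition ideal_gen G : set R := smallest is_ideal G.

(* The empty product makes [ideal_pow I 0] the unit ideal. *)
Definition ideal_pow I k : set R :=
  ideal_gen [set \prod_(i < k) g i | g in [set g : 'I_k -> R | forall i, I (g i)]].

Definition radical I : set R := [set f | exists m : nat, I (f ^+ m)].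

End Ideals.

Section SymbolicPowers.
Variables (K : fieldType) (n : nat).
Implicit Types (I : set {mpoly K[n]}) (e : 'X_{1..n}) (D : seq 'X_{1..n}).

(* An irreducible monomial ideal is encoded by a multi-exponent [e]: the
   variables with exponent 0 do not occur among the generators. *)
Definition irr_ideal e : set {mpoly K[n]} :=
  ideal_gen [set 'X_i ^+ e i | i in [set i | (0 < e i)%N]].

Definition irredundant_decomposition I D : Prop :=
  I = \bigcap_(e in [set` D]) irr_ideal e /\
  forall e, e \in D -> I <> \bigcap_(e' in [set` rem e D]) irr_ideal e'.

(* The component, in the canonical primary decomposition, with the same
   radical as [irr_ideal e]. *)
Definition primary_component D e : set {mpoly K[n]} :=
  \bigcap_(e' in [set e' | e' \in D /\
                    radical (irr_ideal e') = radical (irr_ideal e)])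
    irr_ideal e'.

(* Meaningful for monomial ideals [I] only: these have a unique irredundant
   decomposition, up to the order of the components. *)
Definition symbolic_power I (k : nat) : set {mpoly K[n]} :=
  [set f | exists2 D, irredundant_decomposition I D &
     forall e, e \in D -> ideal_pow (primary_component D e) k f].

(* A(I), inside S[t] with t the variable of [{poly _}]. *)
Definition symbolic_algebra I : set {poly {mpoly K[n]}} :=
  [set p | forall k, symbolic_power I k p`_k].

End SymbolicPowers.

Section GeneratorDegree.
Variable R : comNzRingType.
Implicit Types (A G B : set {poly R}) (d : nat).

Definition is_subalgebra B : Prop :=
  [/\ (forall c : R, B c%:P), (forall p q, B p -> B q -> B (p + q))
    & (forall p q, B p -> B q -> B (p * q))].

Definition algebra_gen G : set {poly R} := smallest is_subalgebra G.

Definition homogeneous k (p : {poly R}) : Prop := exists c : R, p = c *: 'X^k.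

Definition generated_in_degree_le A d : Prop :=
  exists2 G : set {poly R},
    (forall p, G p -> exists2 k, (k <= d)%N & homogeneous k p) &
    A = algebra_gen G.

(* [is_generator_degree A d] says that d(A) = d. *)
Definition is_generator_degree A d : Prop :=
  generated_in_degree_le A d /\
  forall d', generated_in_degree_le A d' -> (d <= d')%N.

End GeneratorDegree.

Section EdgeIdeal.
Variables (K : fieldType) (r s : nat).

Definition xvar (i : 'I_r) : {mpoly K[r + s]} := 'X_(lshift s i).
Definition yvar (j : 'I_s) : {mpoly K[r + s]} := 'X_(rshift r j).

(* A bipartite graph on the x's and the y's is given by the set [E] of the
   pairs (i, j) such that {x_i, y_j} is an edge. *)
Definition weighted_edge_ideal (E : {set 'I_r * 'I_s}) (a b : 'I_r -> 'I_s -> nat)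
    : set {mpoly K[r + s]} :=
  \bigcap_(p in [set` E])
    ideal_gen [set xvar p.1 ^+ a p.1 p.2; yvar p.2 ^+ b p.1 p.2].

End EdgeIdeal.

Arguments weighted_edge_ideal K {r s} E a b _.

(* Main.v *)
(* The components of the edge ideal have pairwise incomparable radicals, so they
   are the canonical primary components, and a monomial x^m lies in I^(k) iff
   m_i %/ a_ij + m_j %/ b_ij >= k for every edge {x_i, y_j}.  For two edges
   (v^a, u1^b) and (v^c, u2^f) sharing v, with a <= c, a = g a', c = g c' and
   g = gcd(a, c), the monomial v^(a c') u2^(f (c' - a')), multiplied by a high
   power of all the variables other than v, u1, u2, is in I^(c').  It is not in
   the subalgebra generated in degrees < c': in any factorization inside A(I),
   its v, u1, u2-part belongs to a single factor, of degree c'.  Hence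
   c' <= d(A(I)), while a' <= c'. *)

Require Import Defs.
From mathcomp Require Import all_boot all_order all_algebra.
From mathcomp Require Import classical_sets.
From mathcomp Require Import mpoly.
From mathcomp Require Import zify.

Set Implicit Arguments.
Unset Strict Implicit.
Unset Printing Implicit Defensive.

Import GRing.Theory.

Local Open Scope classical_set_scope.
Local Open Scope ring_scope.

(** * Generated ideals and their powers *)

Lemma ideal_gen_is_ideal (R : comNzRingType) (G : set R) :
  is_ideal (ideal_gen G).
Proof.
split=> [I [[I0 _ _] _] //|f g If Ig I sI|f g Ig I sI].
- by have [[_ ID _] _] := sI; apply: ID; [apply: If|apply: Ig].
- by have [[_ _ IM] _] := sI; apply: IM; apply: Ig.
Qed.

Lemma ideal_sum (R : comNzRingType) (I : set R) (T : eqType) (r : seq T)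
    (F : T -> R) :
  is_ideal I -> {in r, forall x, I (F x)} -> I (\sum_(x <- r) F x).
Proof.
case=> I0 ID _ IF; rewrite big_seq.
by elim/big_ind: _ => // x; apply: IF.
Qed.

Lemma ideal_prod_pow (R : comNzRingType) (I : set R) (s : seq R) :
  {in s, forall x, I x} -> ideal_pow I (size s) (\prod_(x <- s) x).
Proof.
move=> Is; apply: sub_gen_smallest; exists (fun i : 'I_(size s) => s`_i).
  by move=> i; apply/Is/mem_nth.
by rewrite [RHS](big_nth 0) big_mkord.
Qed.

Lemma ideal_powS (R : comNzRingType) (I J : set R) (k : nat) :
  I `<=` J -> ideal_pow I k `<=` ideal_pow J k.
Proof.
move=> IJ; apply: smallest_sub; first exact: ideal_gen_is_ideal.
move=> _ [g Ig <-]; apply: sub_gen_smallest.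
by exists g => // i; apply/IJ/Ig.
Qed.

(** * Irreducible monomial ideals and the symbolic powers of their intersections *)

Section MonomialIdeals.
Variables (K : fieldType) (n : nat).
Implicit Types (e m : 'X_{1..n}) (f g : {mpoly K[n]}) (k : nat)
  (D : seq 'X_{1..n}).

(* The [k]-th power of [irr_ideal e] is spanned by the monomials of weight at
   least [k]; variables outside the support of [e] do not count, since
   [m %/ 0 = 0]. *)
Definition wt e m : nat := \sum_(i < n) m i %/ e i.

Lemma wtD e m1 m2 : (wt e m1 + wt e m2 <= wt e (m1 + m2)%MM)%N.
Proof.
rewrite -big_split leq_sum // => i _; rewrite mnmDE.
have [->|e0] := posnP (e i); first by rewrite !divn0.
by rewrite leq_divRL // mulnDl leq_add // leq_divM.
Qed.

Lemma wt_gt0 e m :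
  reflect (exists2 i, 0 < e i & e i <= m i)%N (0 < wt e m)%N.
Proof.
rewrite lt0n sum_nat_eq0 negb_forall.
apply: (iffP existsP) => -[i]; rewrite /= -?lt0n; last first.
  by move=> e0 em; exists i; rewrite -lt0n divn_gt0.
by have [->|e0] := posnP (e i); rewrite ?divn0 // divn_gt0 //; exists i.
Qed.

Lemma wt_edge (v u : 'I_n) (x y : nat) m : v != u ->
  wt (U_(v) *+ x + U_(u) *+ y)%MM m = (m v %/ x + m u %/ y)%N.
Proof.
move=> vu; rewrite /wt (bigD1 v) // (bigD1 u) 1?eq_sym //= big1 => [|i].
  rewrite !mnmDE !mulmnE !mnm1E !eqxx (negPf vu) eq_sym (negPf vu).
  by rewrite !mul1n !mul0n addn0 add0n addn0.
move=> /andP[iv iu]; rewrite mnmDE !mulmnE !mnm1E.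
by rewrite eq_sym (negPf iv) eq_sym (negPf iu) !mul0n divn0.
Qed.

Lemma lepm_single e m i : (e i <= m i)%N -> (U_(i) *+ e i <= m)%MM.
Proof.
move=> le_em; apply/mnm_lepP=> j; rewrite mulmnE mnm1E.
by case: eqP => [<-|_]; rewrite ?mul1n ?mul0n.
Qed.

Lemma ideal_monomials (I : set {mpoly K[n]}) f :
  is_ideal I -> {in msupp f, forall m, I 'X_[m]} -> I f.
Proof.
move=> idI Im; rewrite [f]mpolyE; apply: ideal_sum => // m /Im ?.
by rewrite -mul_mpolyC; have [_ _] := idI; apply.
Qed.

Lemma msupp_ge_ideal e k :
  is_ideal [set f : {mpoly K[n]} | {in msupp f, forall m, (k <= wt e m)%N}].
Proof.
split=> [m|f g kf kg m|f g kg m]; first by rewrite msupp0.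
- by move/msuppD_le; rewrite mem_cat => /orP[/kf|/kg].
- move/msuppM_le/allpairsP=> [[m1 m2] /= [_ /kg k2 ->]].
  by rewrite (leq_trans k2) // (leq_trans _ (wtD _ _ _)) // leq_addl.
Qed.

Lemma irr_ideal_ge e f : irr_ideal e f -> {in msupp f, forall m, (0 < wt e m)%N}.
Proof.
apply: (smallest_sub (msupp_ge_ideal e 1)) => _ [i /= ei <-] m.
rewrite mpolyXn msuppX inE => /eqP->.
by apply/wt_gt0; exists i => //; rewrite mulmnE mnm1E eqxx mul1n.
Qed.

Lemma irr_ideal_pow_ge e k f :
  ideal_pow (irr_ideal e) k f -> {in msupp f, forall m, (k <= wt e m)%N}.
Proof.
apply: (smallest_sub (msupp_ge_ideal e k)) => _ [g /= Ig <-].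
elim: k => [|k IHk] in g Ig * => // m.
rewrite big_ord_recl => /msuppM_le/allpairsP[[m1 m2] /= [m1g m2g ->]].
rewrite (leq_trans _ (wtD _ _ _)) // -add1n leq_add //.
  exact: irr_ideal_ge m1g.
exact: (IHk (fun i => g (lift ord0 i))).
Qed.

Lemma irr_ideal_pow_monomial e k m :
  (k <= wt e m)%N -> ideal_pow (irr_ideal e) k ('X_[m] : {mpoly K[n]}).
Proof.
(* Peeling off one generator at a time exhibits [k] factors from the ideal. *)
move=> km; suff [s [h [sk Is ->]]] : exists (s : seq {mpoly K[n]}) h,
    [/\ size s = k, {in s, forall x, irr_ideal e x}
      & 'X_[m] = h * \prod_(x <- s) x].
  have [_ _ IM] : is_ideal (ideal_pow (@irr_ideal K n e) k).
    exact: ideal_gen_is_ideal.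
  by apply: IM; rewrite -sk; apply: ideal_prod_pow.
elim: k => [|k IHk] in m km *.
  by exists [::], 'X_[m]; rewrite big_nil mulr1.
have /wt_gt0[i e_gt0 le_em] : (0 < wt e m)%N by apply: leq_trans km.
have le_m := lepm_single le_em.
have [|s [h [sk Is Eh]]] := IHk (m - U_(i) *+ e i)%MM.
  (* Dividing by ['X_i ^+ e i] lowers the [i]-th quotient by exactly one and leaves the others
     unchanged. *)
  rewrite -ltnS (leq_trans km) // /wt (bigD1 i) //=.
  rewrite [X in (_ <= X.+1)%N](bigD1 i) //= -addSn leq_add //.
    rewrite mnmBE mulmnE mnm1E eqxx mul1n -{1}(subnK le_em).
    by rewrite divnDr ?dvdnn // divnn e_gt0 addn1.
  apply: leq_sum => j ji; rewrite mnmBE mulmnE mnm1E eq_sym (negPf ji).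
  by rewrite mul0n subn0.
exists ('X_i ^+ e i :: s), h; split=> /=; first by rewrite sk.
  move=> x; rewrite inE => /predU1P[->|/Is//].
  by apply: sub_gen_smallest; exists i.
by rewrite -(submK le_m) mpolyXD Eh big_cons mpolyXn -mulrA [_ * 'X_[_]]mulrC.
Qed.

Lemma irr_ideal_powP e k f :
  ideal_pow (irr_ideal e) k f <-> {in msupp f, forall m, (k <= wt e m)%N}.
Proof.
split=> [|km]; first exact: irr_ideal_pow_ge.
apply: ideal_monomials => [|m /km]; first exact: ideal_gen_is_ideal.
exact: irr_ideal_pow_monomial.
Qed.

Lemma irr_idealP e f :
  irr_ideal e f <-> {in msupp f, forall m, (0 < wt e m)%N}.
Proof.
split=> [|gt0]; first exact: irr_ideal_ge.
apply: ideal_monomials => [|m /gt0/wt_gt0[i ei /lepm_single le_m]].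
  exact: ideal_gen_is_ideal.
have [_ _ IM] : is_ideal (@irr_ideal K n e) by exact: ideal_gen_is_ideal.
rewrite -(submK le_m) mpolyXD; apply: IM.
by apply: sub_gen_smallest; exists i; rewrite // mpolyXn.
Qed.

(** The conclusion expresses [irr_ideal e']<=[irr_ideal e] on exponents. If it failed for every
    [e'], one monomial outside [irr_ideal e] would lie in all the components. *)
Lemma irr_ideal_subP D e :
  \bigcap_(e' in [set` D]) irr_ideal e' `<=` @irr_ideal K n e ->
  exists2 e', e' \in D & forall i, (0 < e' i -> 0 < e i <= e' i)%N.
Proof.
move=> sDe; have [/hasP[e' De' /forallP le_e]|/hasPn ND] :=
    boolP (has (fun e' => [forall i, (0 < e' i) ==> (0 < e i <= e' i)])%N D).
  by exists e' => // i; apply/implyP.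
pose N := (\sum_(e' <- D) mdeg e')%N.
(* The largest monomial, up to exponent [N], outside [irr_ideal e]. *)
pose m := [multinom if e i == 0%N then N else (e i).-1 | i < n].
suff /sDe/irr_idealP/(_ m) : (\bigcap_(e' in [set` D]) irr_ideal e')
    ('X_[m] : {mpoly K[n]}).
  rewrite msuppX mem_head => /(_ isT)/wt_gt0[i].
  by rewrite mnmE; case: (e i) => //= k _; rewrite ltnn.
move=> e' /= De'; apply/irr_idealP => _ /[!msuppX]/[!inE] /eqP->.
(* At this [i] either [e i = 0] or [e i > e' i]; in both cases the exponent of [m] reaches
   [e' i]. *)
have /forallPn[i] := ND _ De'; rewrite negb_imply => /andP[e'0 Ne].
apply/wt_gt0; exists i => //; rewrite mnmE.
have [e0|e0] := eqVneq (e i) 0%N; last by lia.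
rewrite /N (big_rem e') //= (leq_trans _ (leq_addr _ _)) // mdegE.
by rewrite (bigD1 i) // leq_addr.
Qed.

(** Inclusion of supports is inclusion of radicals, so distinct members have incomparable
    radicals. *)
Definition radical_incomparable D : Prop :=
  {in D &, forall e e', (forall i, 0 < e i -> 0 < e' i)%N -> e = e'}.

(** Each component contains one from [D'], which in turn contains one from [D]; incomparability
    closes the chain, so all three coincide. *)
Lemma decomposition_uniq D D' :
  radical_incomparable D ->
  irredundant_decomposition (\bigcap_(e in [set` D]) @irr_ideal K n e) D' ->
  {subset D <= D'}.
Proof.
move=> incD [ED' _] e De.
have [|e' De' le_e'e] := @irr_ideal_subP D' e; first by rewrite -ED' => f; apply.
have [|e'' De'' le_e''e'] := @irr_ideal_subP D e'.
  by rewrite ED' => f; apply.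
have Ee'' : e'' = e.
  by apply: incD => // i /le_e''e'/andP[/le_e'e/andP[]].
suff -> : e = e' by [].
apply/mnmP=> i; move: (le_e'e i) (le_e''e' i); rewrite Ee''.
by case: (e i) (e' i) => [|k] [|l] //= A B; lia.
Qed.

Lemma incomparable_irredundant D :
  radical_incomparable D -> uniq D ->
  irredundant_decomposition (\bigcap_(e in [set` D]) @irr_ideal K n e) D.
Proof.
move=> incD uD; split=> // e De ED.
have [|e'] := @irr_ideal_subP (rem e D) e; first by rewrite -ED => f; apply.
rewrite mem_rem_uniq // inE => /andP[/eqP ne De'] le_e; apply: ne.
by apply: incD => // i /le_e/andP[].
Qed.

Lemma radical_irr_ideal_X e i :
  radical (irr_ideal e) ('X_i : {mpoly K[n]}) <-> (0 < e i)%N.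
Proof.
split=> [[k]|e0]; last first.
  by exists (e i); apply: sub_gen_smallest; exists i.
rewrite mpolyXn => /irr_idealP/(_ (U_(i) *+ k)%MM).
rewrite msuppX mem_head => /(_ isT)/wt_gt0[j]; rewrite mulmnE mnm1E.
by case: eqP => [->//|_]; rewrite mul0n leqn0 => e0 /eqP ej; rewrite ej in e0.
Qed.

(** By incomparability each component is alone in its radical class, so the canonical primary
    components are the irreducible ones. *)
Lemma symbolic_powerP D k f :
  radical_incomparable D -> uniq D ->
  symbolic_power (\bigcap_(e in [set` D]) irr_ideal e) k f <->
  forall e, e \in D -> {in msupp f, forall m, (k <= wt e m)%N}.
Proof.
move=> incD uD; split=> [[D' ED' fD'] e De|kD].
  have De' := decomposition_uniq incD ED' De.
  apply/irr_ideal_powP; apply: ideal_powS (fD' e De') => g; apply.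
  by split.
exists D; first exact: incomparable_irredundant.
move=> e De; have -> : primary_component D e = @irr_ideal K n e.
  rewrite eqEsubset; split=> g; first by apply; split.
  move=> eg e' [De' rad_e']; rewrite (_ : e' = e) //.
  apply: incD => // i /(radical_irr_ideal_X e' i).
  by rewrite rad_e' => /radical_irr_ideal_X.
by apply/irr_ideal_powP/kD.
Qed.

End MonomialIdeals.

(** * A lower bound for the generator degree of a graded algebra *)

(* [bad] exponents of degree [k0] are indecomposable in the sense that one of
   the factors has degree [k0] and is again [bad]. *)
Lemma generator_degree_ge (K : fieldType) (n : nat) (A : set {poly {mpoly K[n]}})
    (T : nat -> 'X_{1..n} -> Prop) (bad : 'X_{1..n} -> Prop) (k0 d : nat) :
  (forall p k m, A p -> m \in msupp p`_k -> T k m) ->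
  (0 < k0)%N ->
  (forall k1 k2 m1 m2, T k1 m1 -> T k2 m2 -> (k1 + k2 = k0)%N ->
     bad (m1 + m2)%MM -> k2 = k0 /\ bad m2 \/ k1 = k0 /\ bad m1) ->
  (exists p m, [/\ A p, m \in msupp p`_k0 & bad m]) ->
  generated_in_degree_le A d -> (k0 <= d)%N.
Proof.
move=> AT k0_gt0 bad_indec [p0 [m0 [Ap0 m0p0 bad0]]] [G Gd EA].
rewrite leqNgt; apply/negP => lt_d.
(* [B] is a subalgebra by [bad_indec], and it contains the generators because their degrees are
   below [k0]. Hence [A] is inside [B], against [p0]. *)
pose B := [set p | A p /\ forall m, m \in msupp p`_k0 -> ~ bad m].
have [AC AD AM] : is_subalgebra A.
  rewrite EA; split=> [c C [[? _ _] _] //|p q Gp Gq C sC|p q Gp Gq C sC].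
    by have [[_ CD _] _] := sC; apply: CD; [apply: Gp|apply: Gq].
  by have [[_ _ CM] _] := sC; apply: CM; [apply: Gp|apply: Gq].
have BA : A `<=` B.
  rewrite [X in X `<=` _]EA; apply: smallest_sub.
    split=> [c|p q [Ap Bp] [Aq Bq]|p q [Ap Bp] [Aq Bq]].
    - split=> // m; rewrite coefC.
      by case: eqP => [k00|_]; [rewrite k00 in k0_gt0|rewrite msupp0].
    - split=> [|m]; first exact: AD.
      by rewrite coefD => /msuppD_le; rewrite mem_cat => /orP[/Bp|/Bq].
    - split=> [|m]; first exact: AM.
      rewrite coefM => /msupp_sum_le/flatten_mapP[i _].
      move=> /msuppM_le/allpairsP[[m1 m2] /= [m1p m2q ->]] bad_m.
      have le_i : (i <= k0)%N by rewrite -ltnS.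
      have [||||] := bad_indec i (k0 - i)%N m1 m2 _ _ _ bad_m.
      + exact: AT m1p.
      + exact: AT m2q.
      + by rewrite subnKC.
      + by case=> E bad2; apply: (Bq m2); rewrite // -E.
      + by case=> E bad1; apply: (Bp m1); rewrite // -E.
  move=> p Gp; split=> [|m]; first by rewrite EA; apply: sub_gen_smallest.
  have [k le_k [c ->]] := Gd p Gp; rewrite coefZ coefXn.
  by rewrite gtn_eqF ?mulr0 ?msupp0 // (leq_ltn_trans le_k).
by have [_ /(_ m0 m0p0)] := BA p0 Ap0.
Qed.

(** * Arithmetic of the critical exponents *)

Lemma addn_tight (x1 x2 y1 y2 : nat) :
  (x1 <= y1 -> x2 <= y2 -> y1 + y2 = x1 + x2 -> y1 = x1 /\ y2 = x2)%N.
Proof. lia. Qed.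

(* [p1 + p2] and [t1 + t2] are the exponents of v and u2 in the critical
   monomial.  All the inequalities are tight: [g * a] divides [p1], and
   [g * c] divides [p1] as well, so [c] divides [k1]. *)
Lemma indecomposable_exponent (g a c f k1 k2 p1 p2 t1 t2 : nat) :
  (0 < g -> 0 < a -> a <= c -> 0 < f -> coprime a c ->
   k1 <= p1 %/ (g * a) -> k2 <= p2 %/ (g * a) ->
   k1 <= p1 %/ (g * c) + t1 %/ f -> k2 <= p2 %/ (g * c) + t2 %/ f ->
   k1 + k2 = c -> p1 + p2 = g * a * c -> t1 + t2 = f * (c - a) ->
   [/\ k2 = c, p2 = g * a * c & t2 = f * (c - a)] \/
   [/\ k1 = c, p1 = g * a * c & t1 = f * (c - a)])%N.
Proof.
move=> g0 a0 ac f0 cop K1 K2 T1 T2 Ek Ep Et.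
have c0 : (0 < c)%N by apply: leq_trans ac.
have ga0 : (0 < g * a)%N by rewrite muln_gt0 g0.
have [|||Ep1 Ep2] := @addn_tight (k1 * (g * a)) (k2 * (g * a)) p1 p2.
- by rewrite -leq_divRL.
- by rewrite -leq_divRL.
- by rewrite Ep -mulnDl Ek mulnC.
have Dc k : (k * (g * a) %/ (g * c) = k * a %/ c)%N by rewrite mulnCA divnMl.
move: T1 T2; rewrite Ep1 Ep2 !Dc => T1 T2 {K1 K2}.
have le_t : (t1 %/ f + t2 %/ f <= c - a)%N.
  rewrite -(leq_pmul2r f0) mulnDl [leqRHS]mulnC -Et.
  by rewrite leq_add // leq_divM.
(* Adding [T1] and [T2] leaves at least [a] for the two floors, while the exact quotients sum to
   [a]: both divisions are exact. *)
have dvd_k1 : (c %| k1)%N.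
  have le_q : (a <= k1 * a %/ c + k2 * a %/ c)%N.
    move: T1 T2 le_t; move: (_ %/ f)%N (_ %/ f)%N (_ %/ c)%N (_ %/ c)%N => *.
    lia.
  rewrite -(@Gauss_dvdl _ _ a) 1?coprime_sym //; apply/dvdnP.
  exists (k1 * a %/ c)%N; have [|||//] :=
    @addn_tight (k1 * a %/ c * c) (k2 * a %/ c * c) (k1 * a) (k2 * a).
  1,2: exact: leq_divM.
  apply/eqP; rewrite -!mulnDl Ek mulnC eqn_leq leq_mul2r le_q orbT /= mulnDl.
  suff -> : (a * c = k1 * a + k2 * a)%N by rewrite leq_add // leq_divM.
  by rewrite -mulnDl Ek mulnC.
(* As [c] divides [k1 <= c], one factor has degree 0 and the other degree [c]; the latter takes the
   whole monomial. *)
have [k10|k10] := posnP k1; [left|right].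
  have Ek2 : k2 = c by rewrite -Ek k10.
  move: T2; rewrite Ek2 mulKn // -leq_subLR leq_divRL // => T2.
  split=> //; first by rewrite mulnC.
  apply/eqP; rewrite eqn_leq -{1}Et leq_addl /= mulnC //.
have Ek1 : k1 = c.
  by apply/eqP; rewrite eqn_leq -{1}Ek leq_addr dvdn_leq.
move: T1; rewrite Ek1 mulKn // -leq_subLR leq_divRL // => T1.
split=> //; first by rewrite mulnC.
apply/eqP; rewrite eqn_leq -{1}Et leq_addr /= mulnC //.
Qed.

(** * Two components sharing a variable *)

Section TwoEdges.
Variables (K : fieldType) (n : nat) (D : seq 'X_{1..n}).
Variables (v u1 u2 : 'I_n) (a b c f : nat).
Local Notation e1 := (U_(v) *+ a + U_(u1) *+ b)%MM.
Local Notation e2 := (U_(v) *+ c + U_(u2) *+ f)%MM.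
Local Notation I := (\bigcap_(e in [set` D]) @irr_ideal K n e).

(** Every other component has a variable outside [v], [u1], [u2]; a high power of it meets that
    component's condition, so only [e1] and [e2] constrain the critical monomial. *)
Lemma two_edges_degree (d : nat) :
  radical_incomparable D -> uniq D -> e1 \in D -> e2 \in D ->
  v != u1 -> v != u2 -> u1 != u2 -> (0 < a <= c)%N -> (0 < f)%N ->
  (forall e, e \in D -> e != e1 -> e != e2 ->
     exists z, [/\ z != v, z != u1, z != u2 & 0 < e z]%N) ->
  generated_in_degree_le (symbolic_algebra I) d ->
  (c %/ gcdn a c <= d)%N.
Proof.
move=> incD uD De1 De2 vu1 vu2 u12 /andP[a0 ac] f0 others.
have g0 : (0 < gcdn a c)%N by rewrite gcdn_gt0 a0.
have [[a' Ea] [c' Ec]] := (dvdnP (dvdn_gcdl a c), dvdnP (dvdn_gcdr a c)).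
rewrite [X in (X %/ _)%N]Ec mulnK //.
have cop : coprime a' c'.
  by rewrite /coprime -(eqn_pmul2r g0) muln_gcdl -Ea -Ec mul1n.
move: (gcdn a c) g0 Ea Ec => g g0; rewrite ![(_ * g)%N]mulnC => Ea Ec.
have a'0 : (0 < a')%N by move: a0; rewrite Ea muln_gt0 => /andP[].
have a'c' : (a' <= c')%N by rewrite -(leq_pmul2l g0) -Ea -Ec.
have c'0 : (0 < c')%N by apply: leq_trans a'c'.
(* Large enough that [N %/ e z >= c'] whenever [e] is in [D] and [e z > 0]. *)
pose N := (c' * \sum_(e <- D) mdeg e)%N.
pose w : 'X_{1..n} := [multinom if i == v then a * c' else if i == u1 then 0
  else if i == u2 then f * (c' - a') else N | i < n]%N.
have wv : w v = (a * c')%N by rewrite mnmE eqxx.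
have wu1 : w u1 = 0%N by rewrite mnmE eq_sym (negPf vu1) eqxx.
have wu2 : w u2 = (f * (c' - a'))%N.
  by rewrite mnmE eq_sym (negPf vu2) eq_sym (negPf u12) eqxx.
apply: (@generator_degree_ge _ _ _
  (fun k m => k <= m v %/ a + m u1 %/ b /\ k <= m v %/ c + m u2 %/ f)%N
  (fun m => [/\ m v = a * c', m u1 = 0 & m u2 = f * (c' - a')])%N) => //.
- move=> p k m /(_ k)/(symbolic_powerP _ _ incD uD) pk mp.
  by split; [have := pk _ De1 _ mp|have := pk _ De2 _ mp]; rewrite wt_edge.
- move=> k1 k2 m1 m2 [T1 T1'] [T2 T2'] Ek [].
  rewrite !mnmDE => Ev /eqP; rewrite addn_eq0 => /andP[/eqP m1u1 /eqP m2u1] Eu2.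
  move: T1 T2; rewrite m1u1 m2u1 div0n !addn0 => T1 T2.
  rewrite Ea Ec in T1 T2 T1' T2' Ev *.
  have [[-> -> ->]|[-> -> ->]] :=
    indecomposable_exponent g0 a'0 a'c' f0 cop T1 T2 T1' T2' Ek Ev Eu2.
    by left.
  by right.
- exists ('X_[w] *: 'X^c'), w; split=> //; last first.
    by rewrite coefZ coefXn eqxx mulr1 msuppX mem_head.
  move=> k; rewrite coefZ coefXn; apply/symbolic_powerP => // e De m.
  have [->|] := eqVneq k c'; last by rewrite mulr0 msupp0.
  rewrite mulr1 msuppX inE => /eqP->.
  have [->|ne1] := eqVneq e e1; first by rewrite wt_edge // wv mulKn // leq_addr.
  have [->|ne2] := eqVneq e e2.
    (* Since [a * c' = c * a'], the variable [v] contributes [a'] and [u2] the missing [c' - a']. *)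
    rewrite wt_edge // wv wu2 mulKn // Ea Ec -mulnA divnMl // mulnK //.
    by rewrite subnKC.
  have [z [zv zu1 zu2 ez]] := others e De ne1 ne2.
  rewrite /wt (bigD1 z) //= (leq_trans _ (leq_addr _ _)) // leq_divRL //.
  rewrite mnmE (negPf zv) (negPf zu1) (negPf zu2) leq_mul2l (big_rem e) //=.
  by rewrite (leq_trans _ (leq_addr _ _)) ?orbT // mdegE (bigD1 z) //= leq_addr.
Qed.

End TwoEdges.

(** The larger of [a] and [c] gives the larger quotient; when it is [a], the two edges exchange
    roles. *)
Lemma adjacent_edges_degree (K : fieldType) (n : nat) (D : seq 'X_{1..n})
    (v u1 u2 : 'I_n) (a b c f d : nat) :
  let e1 := (U_(v) *+ a + U_(u1) *+ b)%MM in
  let e2 := (U_(v) *+ c + U_(u2) *+ f)%MM in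
  radical_incomparable D -> uniq D -> e1 \in D -> e2 \in D ->
  v != u1 -> v != u2 -> u1 != u2 ->
  (0 < a)%N -> (0 < b)%N -> (0 < c)%N -> (0 < f)%N ->
  (forall e, e \in D -> e != e1 -> e != e2 ->
     exists z, [/\ z != v, z != u1, z != u2 & 0 < e z]%N) ->
  generated_in_degree_le
    (symbolic_algebra (\bigcap_(e in [set` D]) @irr_ideal K n e)) d ->
  (a %/ gcdn a c <= d)%N.
Proof.
move=> e1 e2 incD uD De1 De2 vu1 vu2 u12 a0 b0 c0 f0 others gen.
have [ac|/ltnW ca] := leqP a c.
  apply: leq_trans (two_edges_degree incD uD De1 De2 vu1 vu2 u12 _ f0 others gen).
    exact: leq_div2r.
  by rewrite a0.
rewrite gcdnC; apply: two_edges_degree incD uD De2 De1 vu2 vu1 _ _ b0 _ gen.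
- by rewrite eq_sym.
- by rewrite c0.
move=> e De ne2 ne1; have [z [zv zu1 zu2 ez]] := others e De ne1 ne2.
by exists z.
Qed.

(** Handles the quotients equal to 1 that come from a repeated edge: constants alone cannot produce
    a nonzero element of degree 1. *)
Lemma symbolic_algebra_degree_gt0 (K : fieldType) (n : nat)
    (D : seq 'X_{1..n}) (d : nat) :
  radical_incomparable D -> uniq D ->
  {in D, forall e : 'X_{1..n}, exists i : 'I_n, 0 < e i}%N ->
  generated_in_degree_le
    (symbolic_algebra (\bigcap_(e in [set` D]) @irr_ideal K n e)) d ->
  (0 < d)%N.
Proof.
move=> incD uD nzD.
apply: (@generator_degree_ge _ _ _ (fun _ _ => True) (fun _ => True)) => //.
  by move=> [|[|k1]] [|[|k2]] //; [left|right].
(* The sum of all the exponents is a monomial lying in every component. *)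
pose w : 'X_{1..n} := (\sum_(e <- D) e)%MM.
exists ('X_[w] *: 'X), w; split=> //; last first.
  by rewrite coefZ coefX mulr1 msuppX mem_head.
move=> k; rewrite coefZ coefX; apply/symbolic_powerP => // e De m.
have [->|] := eqVneq k 1%N; last by rewrite mulr0 msupp0.
rewrite mulr1 msuppX inE => /eqP->; have [i ei] := nzD e De.
by apply/wt_gt0; exists i; rewrite // mnm_sumE (big_rem e) //= leq_addr.
Qed.

(** * Exponents of the edges of a bipartite graph *)

Section EdgeExponents.
Variables (r s : nat) (a b : 'I_r -> 'I_s -> nat).

Definition edge_exponent (p : 'I_r * 'I_s) : 'X_{1..r + s} :=
  (U_(lshift s p.1) *+ a p.1 p.2 + U_(rshift r p.2) *+ b p.1 p.2)%MM.

Lemma edge_exponent_l p i :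
  edge_exponent p (lshift s i) = ((p.1 == i) * a p.1 p.2)%N.
Proof.
rewrite mnmDE !mulmnE !mnm1E eq_lshift [rshift _ _ == _]eq_sym eq_lrshift.
by rewrite mul0n addn0.
Qed.

Lemma edge_exponent_r p j :
  edge_exponent p (rshift r j) = ((p.2 == j) * b p.1 p.2)%N.
Proof. by rewrite mnmDE !mulmnE !mnm1E eq_rshift eq_lrshift. Qed.

Definition edge_exponents (E : {set 'I_r * 'I_s}) : seq 'X_{1..r + s} :=
  [seq edge_exponent p | p <- enum E].

Section Positive.
Variable E : {set 'I_r * 'I_s}.
Hypothesis ab_gt0 : forall i j, (i, j) \in E -> (0 < a i j /\ 0 < b i j)%N.

Lemma edge_exponent_gt0 p : p \in E ->
  (0 < edge_exponent p (lshift s p.1) /\ 0 < edge_exponent p (rshift r p.2))%N.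
Proof.
by case: p => i j /ab_gt0; rewrite edge_exponent_l edge_exponent_r !eqxx !mul1n.
Qed.

(** The support of an edge exponent is the pair of endpoints, which determines the edge. *)
Lemma edge_exponent_support p q : p \in E ->
  (forall i, 0 < edge_exponent p i -> 0 < edge_exponent q i)%N -> p = q.
Proof.
move=> /edge_exponent_gt0[pl pr] pq; move: (pq _ pl) (pq _ pr).
rewrite edge_exponent_l edge_exponent_r.
by case: p q {pl pr pq} => [i j] [i' j'] /=; do 2![case: eqP => [->|]].
Qed.

Lemma mem_edge_exponents p : p \in E -> edge_exponent p \in edge_exponents E.
Proof. by move=> Ep; apply: map_f; rewrite mem_enum. Qed.

Lemma edge_exponents_incomparable : radical_incomparable (edge_exponents E).
Proof.
move=> _ _ /mapP[p /[!mem_enum] Ep ->] /mapP[q _ ->].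
by move/(edge_exponent_support Ep)->.
Qed.

Lemma edge_exponents_uniq : uniq (edge_exponents E).
Proof.
rewrite map_inj_in_uniq ?enum_uniq // => p q /[!mem_enum] Ep _ pq.
by apply: edge_exponent_support; rewrite ?pq.
Qed.

Lemma weighted_edge_idealE (K : fieldType) :
  weighted_edge_ideal K E a b =
  \bigcap_(e in [set` edge_exponents E]) irr_ideal e.
Proof.
have irrE p : p \in E -> ideal_gen
    [set xvar K s p.1 ^+ a p.1 p.2; yvar K r p.2 ^+ b p.1 p.2] =
    irr_ideal (edge_exponent p).
  move=> Ep; have [pl pr] := edge_exponent_gt0 Ep.
  rewrite eqEsubset; split; apply: smallest_sub; try exact: ideal_gen_is_ideal.
    move=> _ [->|->]; apply: sub_gen_smallest.
      by exists (lshift s p.1); rewrite // edge_exponent_l eqxx mul1n.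
    by exists (rshift r p.2); rewrite // edge_exponent_r eqxx mul1n.
  move=> _ [k /= + <-]; have [i|j] := fintype.split_ordP k => ->.
    rewrite edge_exponent_l; case: eqP => // <- _; rewrite mul1n.
    by apply: sub_gen_smallest; left.
  rewrite edge_exponent_r; case: eqP => // <- _; rewrite mul1n.
  by apply: sub_gen_smallest; right.
rewrite eqEsubset; split=> f If.
  move=> _ /mapP[p /[!mem_enum] Ep ->]; rewrite -irrE //.
  exact: (If p Ep).
move=> p Ep; rewrite irrE //; apply: If; exact: mem_edge_exponents.
Qed.

(** Bipartiteness enters here: [y_j] and [y_l] are not adjacent, so any other edge has an endpoint
    outside the three vertices. *)
Lemma edge_exponents_others_l (i : 'I_r) (j l : 'I_s) e :
  e \in edge_exponents E ->
  e != edge_exponent (i, j) -> e != edge_exponent (i, l) ->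
  exists z, [/\ z != lshift s i, z != rshift r j, z != rshift r l & 0 < e z]%N.
Proof.
move=> /mapP[[i' j'] /[!mem_enum] Ep ->] ne1 ne2.
have [pl pr] := edge_exponent_gt0 Ep.
have [Ei|ne_i] := eqVneq i' i; last first.
  by exists (lshift s i'); rewrite eq_lshift !eq_lrshift.
subst i'; exists (rshift r j').
rewrite !eq_rshift eq_sym eq_lrshift; split=> //.
  by apply: contra_neq ne1 => ->.
by apply: contra_neq ne2 => ->.
Qed.

Lemma edge_exponents_others_r (i l : 'I_r) (j : 'I_s) e :
  e \in edge_exponents E ->
  e != edge_exponent (i, j) -> e != edge_exponent (l, j) ->
  exists z, [/\ z != rshift r j, z != lshift s i, z != lshift s l & 0 < e z]%N.
Proof.
move=> /mapP[[i' j'] /[!mem_enum] Ep ->] ne1 ne2.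
have [pl pr] := edge_exponent_gt0 Ep.
have [Ej|ne_j] := eqVneq j' j; last first.
  exists (rshift r j'); rewrite eq_rshift.
  by rewrite [rshift _ _ == _]eq_sym eq_lrshift [rshift _ _ == _]eq_sym eq_lrshift.
subst j'; exists (lshift s i').
rewrite !eq_lshift eq_lrshift; split=> //.
  by apply: contra_neq ne1 => ->.
by apply: contra_neq ne2 => ->.
Qed.

End Positive.
End EdgeExponents.

(* The bound for weighted edge ideals *)
Local Close Scope ring_scope.
Local Close Scope classical_set_scope.

Theorem theorem3p1 (K : fieldType) (r s : nat) (E : {set 'I_r * 'I_s})
    (a b : 'I_r -> 'I_s -> nat) (d : nat) :
  E != finset.set0 ->
  (forall i j, (i, j) \in E -> 0 < a i j /\ 0 < b i j) ->
  is_generator_degree (symbolic_algebra (weighted_edge_ideal K E a b)) d ->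
  maxn
    (\max_(i < r) \max_(j < s | (i, j) \in E) \max_(l < s | (i, l) \in E)
        (a i j %/ gcdn (a i j) (a i l)))
    (\max_(i < r) \max_(j < s | (i, j) \in E) \max_(l < r | (l, j) \in E)
        (b i j %/ gcdn (b i j) (b l j)))
  <= d.
Proof.
move=> _ ab_gt0 [gen _]; rewrite (weighted_edge_idealE ab_gt0) in gen.
have incD := edge_exponents_incomparable ab_gt0.
have uD := edge_exponents_uniq ab_gt0.
have d_gt0 : (0 < d)%N.
  apply: symbolic_algebra_degree_gt0 incD uD _ gen.
  move=> _ /mapP[p /[!mem_enum] /(edge_exponent_gt0 ab_gt0)[pl _] ->].
  by exists (lshift s p.1).
rewrite geq_max; apply/andP; split; apply/bigmax_leqP => i _;
  apply/bigmax_leqP => j Eij; apply/bigmax_leqP => l El;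
  have [a1 b1] := ab_gt0 _ _ Eij; have [a2 b2] := ab_gt0 _ _ El;
  have D1 := mem_edge_exponents a b Eij; have D2 := mem_edge_exponents a b El.
- have [->|ne_jl] := eqVneq j l; first by rewrite gcdnn divnn; case: (_ < _)%N.
  apply: (adjacent_edges_degree incD uD D1 D2 _ _ _ _ _ _ _ _ gen) => //.
  + by rewrite eq_lrshift.
  + by rewrite eq_lrshift.
  + by rewrite eq_rshift.
  + exact: edge_exponents_others_l.
- have [->|ne_il] := eqVneq i l; first by rewrite gcdnn divnn; case: (_ < _)%N.
  have others := edge_exponents_others_r ab_gt0.
  (* The shared vertex is now [y_j], so its summand is moved to the front. *)
  rewrite /edge_exponent /= addmC in D1; rewrite /edge_exponent /= addmC in D2.
  apply: (adjacent_edges_degree incD uD D1 D2 _ _ _ _ _ _ _ _ gen) => //.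
  + by rewrite eq_sym eq_lrshift.
  + by rewrite eq_sym eq_lrshift.
  + move=> e De; rewrite ![(U_(rshift _ _) *+ _ + _)%MM]addmC.
    exact: others.
Qed.
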